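(* Let $T$ be a set. The set $\Theta(T)$ of all functions $\theta:\mathcal{F}(T)\to[0,\infty)$ that are the ECF of some simple max-stable process on $T$ is convex (as a subset of $\mathbb{R}^{\mathcal{F}(T)}$).
   Context: $\mathcal{F}(T)$ is the set of finite subsets of $T$. Simple max-stable process: a process $X=\{X_t\}_{t\in T}$ with $\mathbb{P}(X_t\le x)=e^{-1/x}$ for all $t\in T$, $x>0$, such that for every $n\in\mathbb{N}$ and independent copies $X^{(1)},\dots,X^{(n)}$ of $X$ the process $\{\bigvee_{i=1}^nX^{(i)}_t\}_{t\in T}$ has the same law (finite-dimensional distributions) as $\{nX_t\}_{t\in T}$. Extremal coefficient function (ECF) of a simple max-stable process $X$: $\theta:\mathcal{F}(T)\to[0,\infty)$ with $\theta(\varnothing)=0$ and $\theta(A)=-x\log\mathbb{P}(\bigvee_{t\in A}X_t\le x)$ for non-empty finite $A\subset T$ (independent of $x>0$). *)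

(* Defs.v *)
From HB Require Import structures.
From mathcomp Require Import all_boot all_order all_algebra finmap.
From mathcomp Require Import all_classical all_reals all_analysis.
Set Implicit Arguments.
Unset Strict Implicit.
Unset Printing Implicit Defensive.
Import Order.TTheory GRing.Theory Num.Theory.
Import numFieldNormedType.Exports.
Local Open Scope classical_set_scope.
Local Open Scope ring_scope.

Section processes.
Context (R : realType) (T : choiceType).

(* The law of (X_{t_1}, ..., X_{t_k}), a set function on R^k. *)
Definition fdd d (Omega : measurableType d) (P : probability Omega R)
    (X : T -> Omega -> R) (k : nat) (t : k.-tuple T) :
    set (k.-tuple R) -> \bar R :=
  pushforward P (fun w => [tuple X (tnth t i) w | i < k]).

(* R^k carries the product of the Borel sigma-algebras. *)
Definition same_law d (Omega : measurableType d) (P : probability Omega R)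
    (X : T -> Omega -> R)
    d' (Omega' : measurableType d') (P' : probability Omega' R)
    (Y : T -> Omega' -> R) : Prop :=
  forall (k : nat) (t : k.-tuple T) (B : set (k.-tuple R)),
    measurable B -> fdd P X t B = fdd P' Y t B.

Definition sigma_process (Omega : Type) (X : T -> Omega -> R) :
    set (set Omega) :=
  <<s \bigcup_t preimage_set_system [set: Omega] (X t) measurable >>.

Definition mutually_independent d (Omega : measurableType d)
    (P : probability Omega R) (I : finType) (F : I -> set (set Omega)) : Prop :=
  forall (J : {set I}) (E : I -> set Omega),
    (forall i, i \in J -> F i (E i)) ->
    P (\bigcap_(i in [set` J]) E i) = (\prod_(i in J) P (E i))%E.

Definition independent_copies d (Omega : measurableType d)
    (P : probability Omega R) (X : T -> {RV P >-> R})
    d' (Omega' : measurableType d') (P' : probability Omega' R)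
    (n : nat) (Y : 'I_n -> T -> {RV P' >-> R}) : Prop :=
  (forall i, same_law P' (Y i : T -> Omega' -> R) P (X : T -> Omega -> R)) /\
  mutually_independent P' (fun i => sigma_process (Y i : T -> Omega' -> R)).

(* The default value of the iterated maximum is one of its members. *)
Definition max_process (Omega : Type) (n : nat)
    (Y : 'I_n.+1 -> T -> Omega -> R) : T -> Omega -> R :=
  fun t w => \big[Num.max/Y ord0 t w]_(i < n.+1) Y i t w.

(* Copies are indexed by 'I_n.+1, so that n.+1 ranges over the integers >= 1,
   and they may live on any probability space. *)
Definition simple_max_stable d (Omega : measurableType d)
    (P : probability Omega R) (X : T -> {RV P >-> R}) : Prop :=
  (forall (t : T) (x : R), 0 < x ->
     P [set w | X t w <= x] = (expR (- (1 / x)))%:E) /\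
  (forall (n : nat) d' (Omega' : measurableType d')
      (P' : probability Omega' R) (Y : 'I_n.+1 -> T -> {RV P' >-> R}),
    independent_copies X Y ->
    same_law P' (max_process (fun i t => Y i t : Omega' -> R))
             P (fun t w => n.+1%:R * X t w)).

(* The probability below is never 0 when X is simple max-stable, so the
   convention ln 0 = 0 plays no role; the maximum is taken in \bar R, where
   the empty maximum -oo is neutral. *)
Definition is_ECF d (Omega : measurableType d) (P : probability Omega R)
    (X : T -> {RV P >-> R}) (theta : {fset T} -> R) : Prop :=
  theta fset0 = 0 /\
  forall (A : {fset T}) (x : R), A != fset0 -> 0 < x ->
    theta A = - x * ln (fine (P
      [set w | (\big[maxe/-oo]_(t <- A) (X t w)%:E <= x%:E)%E])).

(* R^o makes the functions {fset T} -> R an lmodType over R. *)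
Definition Theta : set ({fset T} -> R^o) :=
  [set theta | (forall A : {fset T}, 0 <= (theta A : R)) /\
    exists d (Omega : measurableType d) (P : probability Omega R)
           (X : T -> {RV P >-> R}),
      simple_max_stable X /\ is_ECF X theta].

End processes.

(* Main.v *)
Require Import Defs.
From mathcomp Require Import all_boot all_order all_algebra finmap.
From mathcomp Require Import all_classical all_reals all_analysis.
From mathcomp Require Import measurable_realfun ring.

(* If X and Y are independent simple max-stable processes and a + b = 1 with
   a, b > 0, then Z_t = max(a X_t, b Y_t) is simple max-stable with ECF
   a theta_X + b theta_Y: the joint distribution functions satisfy
   F_Z(x) = F_X(x / a) F_Y(x / b), and max-stability of a process with joint
   distribution functions F amounts to F(x / n) = F(x)^n. *)

Set Implicit Arguments.
Unset Strict Implicit.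
Unset Printing Implicit Defensive.
Import Order.TTheory GRing.Theory Num.Theory.
Import numFieldNormedType.Exports.
Local Open Scope classical_set_scope.
Local Open Scope convex_scope.
Local Open Scope ring_scope.

(** * Orthants as generators of the product sigma-algebra *)

Definition orthant (R : realType) k (x : 'I_k -> R) : set (k.-tuple R) :=
  [set y | forall i, tnth y i <= x i].

Lemma preimage_tnth_orthants (R : realType) k (i : 'I_k) (r : R) :
  (fun y : k.-tuple R => tnth y i) @^-1` `]-oo, r] =
  \bigcup_n orthant (fun j => if j == i then r else n%:R).
Proof.
rewrite predeqE => y; split=> [|[n _ /(_ i)]]; last by rewrite eqxx /= in_itv.
rewrite /= in_itv/= => yir.
(* Beyond this integer, every coordinate other than [i] satisfies its bound. *)
exists (\max_(j < k) (Num.truncn `|tnth y j|).+1)%N => // j.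
case: eqP => [->//|_].
apply: (le_trans (ler_norm _)); apply: (le_trans (ltW (truncnS_gt _))).
by rewrite ler_nat; apply: leq_bigmax.
Qed.

Lemma measurable_orthant (R : realType) k (x : 'I_k -> R) :
  measurable (orthant x).
Proof.
rewrite (_ : orthant x =
    \bigcap_i ((fun y : k.-tuple R => tnth y i) @^-1` `]-oo, x i])).
  apply: fin_bigcap_measurable => // i _; rewrite -[X in measurable X]setTI.
  by apply: measurable_tnth => //; exact: measurable_itv.
by rewrite predeqE => y; split=> yx i => [_|]; have := yx i;
  rewrite /= in_itv//=; exact.
Qed.

(** The coordinate preimages of the rays ]r, +oo[ generate the product sigma-algebra, and each is
    the complement of a countable union of orthants. *)
Lemma measurable_tupleE (R : realType) k :
  @measurable _ (k.-tuple R) = <<s range (@orthant R k) >>.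
Proof.
rewrite eqEsubset; split; last first.
  apply: smallest_sub; first exact: sigma_algebra_measurable.
  by move=> _ [x _ <-]; exact: measurable_orthant.
apply: smallest_sub; first exact: smallest_sigma_algebra.
move=> B; rewrite -bigcup_seq => -[i _ [A mA <-]].
suff : measurable `<=` image_set_system setT (fun y : k.-tuple R => tnth y i)
  <<s range (@orthant R k) >> by apply.
rewrite [measurable](RGenOInfty.measurableE R).
apply: smallest_sub; first exact/sigma_algebra_image/smallest_sigma_algebra.
move=> _ [r ->]; rewrite /image_set_system/= setTI -setCitvl.
rewrite [_ @^-1` _](congr1 setC (preimage_tnth_orthants i r)) -setTD.
apply: sigma_algebraCD; apply: sigma_algebra_bigcup => n.
by apply: sub_sigma_algebra; eexists.
Qed.

Lemma orthantI (R : realType) k (x y : 'I_k -> R) :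
  orthant x `&` orthant y = orthant (fun i => Num.min (x i) (y i)).
Proof.
rewrite predeqE => z; split=> [[zx zy] i|zxy]; first by rewrite le_min zx zy.
by split=> i; have := zxy i; rewrite le_min => /andP[].
Qed.

(** The uniqueness of laws uses this exhaustion with [c] equal to 1; the positivity of joint
    distribution functions uses it with [c] equal to the point under study. *)
Lemma bigcup_orthant (R : realType) k (c : R) : 0 < c ->
  \bigcup_n orthant (fun _ : 'I_k => c * n.+1%:R) = setT.
Proof.
move=> c0; rewrite -subTset => y _.
exists (\max_(j < k) Num.truncn (`|tnth y j| / c))%N => // j.
rewrite mulrC -ler_pdivrMr//.
apply: (@le_trans _ _ (`|tnth y j| / c)).
  by rewrite ler_pM2r ?invr_gt0// ler_norm.
apply: (le_trans (ltW (truncnS_gt _))).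
by rewrite ler_nat ltnS; apply: leq_bigmax.
Qed.

(** * Joint distribution functions determine the law *)

Section joint_cdf.
Context (R : realType) (T : choiceType).
Context d (Omega : measurableType d) (P : probability Omega R).
Variable X : T -> Omega -> R.
Hypothesis mX : forall t, measurable_fun setT (X t).

Lemma measurable_fdd_map k (t : k.-tuple T) :
  measurable_fun setT (fun w => [tuple X (tnth t i) w | i < k]).
Proof.
apply/measurable_fun_tnthP => i.
rewrite (_ : _ \o _ = X (tnth t i))//.
by apply/funext => w /=; rewrite tnth_mktuple.
Qed.

Lemma fdd_orthant k (t : k.-tuple T) (x : 'I_k -> R) :
  fdd P X t (orthant x) = P (\bigcap_i [set w | X (tnth t i) w <= x i]).
Proof.
congr (P _); rewrite predeqE => w; split=> [wx i _|wx i].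
  by have := wx i; rewrite tnth_mktuple.
by rewrite tnth_mktuple; exact: wx.
Qed.

End joint_cdf.

(** Uniqueness of measures on a pi-system: orthants are stable under intersection, generate the
    sigma-algebra, and countably many of them, all of finite measure, cover the space. *)
Lemma same_lawP (R : realType) (T : choiceType)
    d (Omega : measurableType d) (P : probability Omega R) (X : T -> Omega -> R)
    d' (Omega' : measurableType d') (P' : probability Omega' R)
    (Y : T -> Omega' -> R) :
  (forall t, measurable_fun setT (X t)) ->
  (forall t, measurable_fun setT (Y t)) ->
  same_law P X P' Y <->
  forall k (t : k.-tuple T) (x : 'I_k -> R),
    fdd P X t (orthant x) = fdd P' Y t (orthant x).
Proof.
move=> mX mY; split=> [XY k t x|XY k t B mB].
  by apply: XY; exact: measurable_orthant.
apply: (measure_unique (range (@orthant R k))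
  (fun n => orthant (fun=> 1 * n.+1%:R))
  (measurable_tupleE R k) _ _ (bigcup_orthant k ltr01)
  (pushforward P _)
  (pushforward P' _)) => //=; rewrite -/(fdd _ _ _) -/(fdd _ _ _).
- by move=> _ _ [x _ <-] [y _ <-]; rewrite orthantI; eexists.
- by move=> n; eexists.
- exact: measurable_fdd_map.
- exact: measurable_fdd_map.
- by move=> _ _ _ [x _ <-]; exact: XY.
- move=> mf n; apply: le_lt_trans (ltry 1); apply: probability_le1.
  rewrite -[X in measurable X]setTI.
  by apply: mf => //; exact: measurable_orthant.
Qed.

(** * Finite powers of a probability space and independent copies *)

Lemma product_power (R : realType) d (Omega : measurableType d)
    (P : probability Omega R) (n : nat) :
  exists d' (Omega' : measurableType d') (P' : probability Omega' R)
      (pr : 'I_n -> Omega' -> Omega),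
    (forall i, measurable_fun setT (pr i)) /\
    forall E : 'I_n -> set Omega, (forall i, measurable (E i)) ->
      P' (\bigcap_i (pr i @^-1` E i)) = (\prod_i P (E i))%E.
Proof.
elim: n => [|n [d2 [W [P2 [pr [mpr prE]]]]]].
  exists d, Omega, P, (fun=> id); split=> [|E mE]; first by case.
  rewrite big_ord0 (_ : \bigcap_i _ = setT) ?probability_setT//.
  by rewrite -subTset => w _ [].
(* Coordinate 0 reads the new factor [Omega]; the others are shifted by one and factor through
   [W]. *)
exists _, (Omega * W)%type, (P \x P2)%E,
  (fun i => if unlift ord0 i is Some j then pr j \o snd else fst); split.
  move=> i; case: unliftP => [j _|_]; last exact: measurable_fst.
  exact: measurableT_comp (mpr j) measurable_snd.
move=> E mE.
rewrite big_ord_recl -prE => [|i]; last exact: mE.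
rewrite -product_measure1E//; last first.
  apply: fin_bigcap_measurable => // i _; rewrite -[X in measurable X]setTI.
  exact: mpr.
congr (_ _); rewrite predeqE => -[w w']; split=> /= [H|[H0 H] i _].
  split=> [|j _]; first by have := H ord0 I; rewrite unlift_none.
  by have := H (lift ord0 j) I; rewrite liftK.
by case: unliftP => [j ->|->] //; exact: H.
Qed.

Lemma product_power_independent (R : realType) d (Omega : measurableType d)
    (P : probability Omega R) (n : nat) :
  exists d' (Omega' : measurableType d') (P' : probability Omega' R)
      (pr : 'I_n -> Omega' -> Omega),
    (forall i, measurable_fun setT (pr i)) /\
    forall (J : {set 'I_n}) (E : 'I_n -> set Omega),
      (forall i, i \in J -> measurable (E i)) ->
      P' (\bigcap_(i in [set` J]) (pr i @^-1` E i)) =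
      (\prod_(i in J) P (E i))%E.
Proof.
have [d2 [W [P2 [pr [mpr prE]]]]] := product_power P n.
exists d2, W, P2, pr; split=> // J E mE.
rewrite big_mkcond/= -[X in P2 X]setIT.
(* Indices outside [J] are given the whole space, which contributes a factor 1. *)
rewrite (eq_bigr (fun i => P (if i \in J then E i else setT))) => [|i _].
  rewrite -prE => [|i]; last by case: ifPn => // /mE.
  congr (P2 _); rewrite predeqE => w; split=> [[wE _] i _|wE].
    by case: ifPn => // /wE.
  by split=> // i /= iJ; have := wE i I; rewrite iJ.
by case: ifPn => // _; rewrite probability_setT.
Qed.

Lemma bigcap_finset1 (I : finType) (U : Type) (i : I) (F : I -> set U) :
  \bigcap_(j in [set` [set i]%SET]) F j = F i.
Proof.
rewrite (_ : [set` _] = [set i]) ?bigcap_set1//.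
by rewrite predeqE => j /=; rewrite inE; split=> /eqP.
Qed.

Section sigma_process.
Context (R : realType) (T : choiceType).

(** The preimages under [f] of members of [S] form a sigma-algebra containing the generators. With
    [f] a projection, every event of a copy of the process is thus a cylinder. *)
Lemma sigma_process_comp (Omega Omega' : Type) (X : T -> Omega -> R)
    (S : set (set Omega)) (f : Omega' -> Omega) :
  sigma_algebra setT S ->
  (forall t A, measurable A -> S (X t @^-1` A)) ->
  sigma_process (fun t => X t \o f) `<=` preimage_set_system setT f S.
Proof.
move=> sS SX; apply: smallest_sub; first exact: sigma_algebra_preimage.
move=> _ [t _ [A mA <-]]; exists (X t @^-1` A); first exact: SX.
by [].
Qed.

Lemma sigma_process_orthant d (Omega : measurableType d) (X : T -> Omega -> R)
    k (t : k.-tuple T) (x : 'I_k -> R) :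
  sigma_process X (\bigcap_i [set w | X (tnth t i) w <= x i]).
Proof.
pose G := \bigcup_t preimage_set_system [set: Omega] (X t) measurable.
suff : G.-sigma.-measurable (\bigcap_i [set w | X (tnth t i) w <= x i]) by [].
apply: fin_bigcap_measurable => // i _; apply: sub_sigma_algebra.
exists (tnth t i) => //; exists `]-oo, x i]%classic.
  exact: measurable_itv.
by rewrite setTI predeqE => w; rewrite /= in_itv.
Qed.

End sigma_process.

Section simple_max_stable.
Context (R : realType) (T : choiceType).
Context d (Omega : measurableType d) (P : probability Omega R).
Variable X : T -> {RV P >-> R}.

Lemma exists_independent_copies n :
  exists d' (Omega' : measurableType d') (P' : probability Omega' R)
    (Y : 'I_n -> T -> {RV P' >-> R}), independent_copies X Y.
Proof.
have [d2 [W [P2 [pr [mpr prE]]]]] := product_power_independent P n.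
have mY i t : measurable_fun setT (X t \o pr i) by exact: measurableT_comp.
exists d2, W, P2, (fun i t => mfun_Sub (mem_set (mY i t))); split.
  move=> i k t B mB.
  pose f w := [tuple X (tnth t l) w | l < k].
  have mfB : measurable (f @^-1` B).
    rewrite -[X in measurable X]setTI.
    exact: (@measurable_fdd_map _ _ _ _ (fun t => X t)).
  (* For a single index, the product formula says that [pr i] preserves the measure. *)
  have := prE [set i]%SET (fun=> f @^-1` B) (fun _ _ => mfB).
  by rewrite big_set1 bigcap_finset1.
move=> J E sE.
(* Each event is replaced by the base of its cylinder, so that the product formula applies. *)
have /choice[A AE] i : exists A, i \in J ->
    measurable A /\ E i = pr i @^-1` A.
  have [iJ|] := boolP (i \in J); last by exists setT.
  have [||A mA <-] := @sigma_process_comp _ _ _ _ (fun t => X t) measurable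
    (pr i) _ _ _ (sE i iJ).
  - exact: sigma_algebra_measurable.
  - by move=> t A mA; exact: measurable_funPTI.
  - by exists A => _; rewrite setTI.
rewrite (eq_bigr (fun i => P (A i))); last first.
  move=> i iJ; have [mA ->] := AE i iJ.
  have mAi j : j \in [set i]%SET -> measurable (A j) by rewrite inE => /eqP ->.
  by have := prE _ _ mAi; rewrite big_set1 bigcap_finset1.
rewrite -prE => [|i /AE[]//].
by congr (P2 _); apply: eq_bigcapr => i /= /AE[].
Qed.

End simple_max_stable.

(** * Max-stability as an equation for joint distribution functions *)

Lemma fdd_max_process (R : realType) (T : choiceType)
    d (Omega : measurableType d) (P : probability Omega R) n
    (Y : 'I_n.+1 -> T -> {RV P >-> R}) k (t : k.-tuple T) (x : 'I_k -> R) :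
  mutually_independent P
    (fun i => sigma_process (fun t => Y i t : Omega -> R)) ->
  fdd P (max_process (fun i t => Y i t : Omega -> R)) t (orthant x) =
  (\prod_(i < n.+1) fdd P (fun t => Y i t : Omega -> R) t (orthant x))%E.
Proof.
move=> indY.
pose E i := \bigcap_j [set w | Y i (tnth t j) w <= x j].
transitivity (P (\bigcap_(i in [set` [set: 'I_n.+1]%SET]) E i)).
  rewrite fdd_orthant; congr (P _); rewrite predeqE => w.
  split=> [H i _ j _|H j _].
    by have /bigmax_leP[_ /(_ i isT)] := H j I.
  (* The default value of the maximum must be bounded too; it is copy 0. *)
  apply/bigmax_leP; split=> [|i _].
    by apply: (H ord0 _ j); rewrite /= ?inE.
  by apply: (H i _ j); rewrite /= ?inE.
rewrite indY => [|i _]; last exact: sigma_process_orthant.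
by apply: eq_big => [i|i _]; rewrite ?inE// fdd_orthant.
Qed.

Lemma measurable_max_process (R : realType) (T : choiceType)
    d (Omega : measurableType d) n (Y : 'I_n.+1 -> T -> Omega -> R) t :
  (forall i, measurable_fun setT (Y i t)) ->
  measurable_fun setT (max_process Y t).
Proof.
move=> mY; rewrite /max_process.
elim: (index_enum _) => [|i s IHs].
  by under eq_fun do rewrite big_nil; exact: mY.
under eq_fun do rewrite big_cons; exact: measurable_maxr.
Qed.

Section fdd_orthant.
Context (R : realType) (T : choiceType).
Context d (Omega : measurableType d) (P : probability Omega R).
Implicit Types X : T -> Omega -> R.

Lemma fdd_orthantM X c k (t : k.-tuple T) (x : 'I_k -> R) : 0 < c ->
  fdd P (fun t w => c * X t w) t (orthant x) =
  fdd P X t (orthant (fun i => x i / c)).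
Proof.
move=> c0; rewrite !fdd_orthant; congr (P _); apply: eq_bigcapr => i _.
by rewrite predeqE => w /=; rewrite ler_pdivlMr// mulrC.
Qed.

Lemma fdd_orthant1 X t (x : R) :
  fdd P X [tuple t] (orthant (fun=> x)) = P [set w | X t w <= x].
Proof.
rewrite fdd_orthant; congr (P _); rewrite predeqE => w.
split=> [/(_ ord0 I)//|].
by move=> Xx i _ /=; rewrite (ord1 i).
Qed.

Lemma fdd_orthant_fin_num X k (t : k.-tuple T) x :
  (forall t, measurable_fun setT (X t)) ->
  fdd P X t (orthant x) \is a fin_num.
Proof.
move=> mX; apply: fin_num_measure; rewrite -[X in measurable X]setTI.
by apply: measurable_fdd_map => //; exact: measurable_orthant.
Qed.

(** This reads the probability in the definition of the ECF as a joint distribution function on the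
    diagonal, with [A] enumerated as a tuple. *)
Lemma fdd_orthant_bigmax X (A : {fset T}) (x : R) :
  P [set w | (\big[maxe/-oo]_(t <- A) (X t w)%:E <= x%:E)%E] =
  fdd P X (in_tuple A) (orthant (fun=> x)).
Proof.
rewrite fdd_orthant; congr (P _); rewrite predeqE => w /=.
rewrite (big_tnth _ _ (enum_fset A))/=.
split=> [/bigmax_leP[_ H] i _ /=|H]; first by have := H i isT; rewrite lee_fin.
by apply/bigmax_leP; split=> [|i _]; rewrite ?leNye// lee_fin; exact: H.
Qed.

End fdd_orthant.

(* The definition only constrains independent copies that are given, so the
   direct implication relies on their existence. *)
Lemma simple_max_stableP (R : realType) (T : choiceType)
    d (Omega : measurableType d) (P : probability Omega R)
    (X : T -> {RV P >-> R}) :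
  simple_max_stable X <->
  (forall (t : T) (x : R), 0 < x ->
     P [set w | X t w <= x] = (expR (- (1 / x)))%:E) /\
  (forall n k (t : k.-tuple T) (x : 'I_k -> R),
     fdd P (fun t => X t : Omega -> R) t (orthant (fun i => x i / n.+1%:R)) =
     (\prod_(i < n.+1) fdd P (fun t => X t : Omega -> R) t (orthant x))%E).
Proof.
split=> -[X1 XM]; split=> //.
  move=> n k t x.
  have [d2 [W [P2 [Y copY]]]] := exists_independent_copies X n.+1.
  rewrite -fdd_orthantM// -(XM _ _ _ _ _ copY); last exact: measurable_orthant.
  have [lawY indY] := copY.
  rewrite fdd_max_process//; apply: eq_bigr => i _.
  by apply: lawY; exact: measurable_orthant.
move=> n d2 W P2 Y [lawY indY]; apply/same_lawP.
- by move=> t; exact: measurable_max_process.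
- by move=> t; exact: measurable_funM.
move=> k t x; rewrite fdd_max_process// fdd_orthantM// XM.
by apply: eq_bigr => i _; apply: lawY; exact: measurable_orthant.
Qed.

(* A zero of F at x would propagate to n x for all n, but the orthants with
   corners n x exhaust the space. *)
Lemma simple_max_stable_fdd_gt0 (R : realType) (T : choiceType)
    d (Omega : measurableType d) (P : probability Omega R)
    (X : T -> {RV P >-> R}) k (t : k.-tuple T) (x : R) :
  simple_max_stable X -> 0 < x ->
  (0 < fdd P (fun t => X t : Omega -> R) t (orthant (fun=> x)))%E.
Proof.
move=> /simple_max_stableP[_ XM] x0.
have mo y : measurable ((fun w => [tuple X (tnth t i) w | i < k])
    @^-1` orthant (fun=> y)).
  rewrite -[X in measurable X]setTI.
  apply: (@measurable_fdd_map _ _ _ _ (fun t => X t)) => //.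
  exact: measurable_orthant.
have F_ge0 y : (0 <= fdd P (fun t => X t : Omega -> R) t (orthant (fun=> y)))%E.
  by rewrite /fdd /pushforward; exact: measure_ge0.
rewrite lt0e F_ge0 andbT; apply/negP => /eqP Fx0.
suff nT : P.-negligible [set: Omega].
  have : P setT = 0%E by exact: measure_negligible.
  by rewrite probability_setT => /eqP; rewrite onee_eq0.
rewrite -(preimage_setT (fun w => [tuple X (tnth t i) w | i < k])).
rewrite -(bigcup_orthant k x0) preimage_bigcup; apply: negligible_bigcup => n.
apply/negligibleP => //.
apply/eqP; rewrite -[X in X == _]/(fdd P (fun t => X t : Omega -> R) t _).
rewrite eq_le F_ge0 andbT leNgt; apply/negP => Fn0.
(* Max-stability writes F(x) as the power n + 1 of F((n + 1) x), which would be positive. *)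
have := XM n _ t (fun=> x * n.+1%:R).
rewrite (_ : (fun=> _) = fun=> x); last first.
  by apply/funext => i; rewrite mulfK.
rewrite Fx0 => F0; suff : (0 < 0 :> \bar R)%E by rewrite ltxx.
rewrite [X in (_ < X)%E]F0.
by apply: (big_ind (fun y => 0 < y)%E) => [|a b|i _] //; exact: mule_gt0.
Qed.

Lemma measurable_RV_le (R : realType) d (Omega : measurableType d)
    (P : probability Omega R) (f : {RV P >-> R}) (x : R) :
  measurable [set w | f w <= x].
Proof.
rewrite (_ : [set w | _] = f @^-1` `]-oo, x]); first exact: measurable_funPTI.
by rewrite predeqE => w; rewrite /= in_itv.
Qed.

(** * The weighted maximum of two independent processes *)

Section weighted_max.
Context (R : realType) (T : choiceType).
Context d (Omega : measurableType d) (P : probability Omega R).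
Context d' (Omega' : measurableType d') (P' : probability Omega' R).
Variables (X : T -> {RV P >-> R}) (Y : T -> {RV P' >-> R}) (a b : R).
Hypotheses (a0 : 0 < a) (b0 : 0 < b) (ab1 : a + b = 1).

(** The two processes may live on different spaces; reading them off the two coordinates of the
    product space makes them independent. *)
Definition weighted_max t (w : Omega * Omega') : R :=
  Num.max (a * X t w.1) (b * Y t w.2).

Lemma measurable_weighted_max t : measurable_fun setT (weighted_max t).
Proof.
apply: measurable_maxr; apply: measurable_funM => //.
- exact: measurableT_comp measurable_fst.
- exact: measurableT_comp measurable_snd.
Qed.

Definition weighted_max_RV t : {RV (P \x P')%E >-> R} :=
  mfun_Sub (mem_set (measurable_weighted_max t)).

Local Notation F := (fdd P (fun t => X t : Omega -> R)).
Local Notation G := (fdd P' (fun t => Y t : Omega' -> R)).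
Local Notation H := (fdd (P \x P')%E
  (fun t => weighted_max_RV t : Omega * Omega' -> R)).

(** As [a] and [b] are positive, the event is a measurable rectangle, whose product measure
    factors. *)
Lemma fdd_weighted_max k (t : k.-tuple T) (x : 'I_k -> R) :
  H t (orthant x) = (F t (orthant (fun i => (x i / a)%R)) *
                     G t (orthant (fun i => (x i / b)%R)))%E.
Proof.
rewrite !fdd_orthant -product_measure1E/=.
- congr (_ _); rewrite predeqE => -[w w'].
  split=> [Hx|[/= Fx Gx] i _]; last first.
    have := Fx i I; have := Gx i I; rewrite /= !ler_pdivlMr// => Gxi Fxi.
    by rewrite /weighted_max ge_max/= mulrC Fxi mulrC.
  by split=> i _; have := Hx i I;
    rewrite /= ler_pdivlMr// mulrC /weighted_max ge_max/= => /andP[].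
- by apply: fin_bigcap_measurable => // i _; exact: measurable_RV_le.
- by apply: fin_bigcap_measurable => // i _; exact: measurable_RV_le.
Qed.

Hypotheses (msX : simple_max_stable X) (msY : simple_max_stable Y).

Lemma simple_max_stable_weighted_max : simple_max_stable weighted_max_RV.
Proof.
have /simple_max_stableP[X1 XM] := msX; have /simple_max_stableP[Y1 YM] := msY.
apply/simple_max_stableP; split=> [t x x0|n k t x].
  have := fdd_weighted_max [tuple t] (fun=> x).
  rewrite !fdd_orthant1 => ->; rewrite X1 ?divr_gt0// Y1 ?divr_gt0//.
  rewrite -EFinM -expRD; congr (expR _)%:E.
  (* The exponents a / x and b / x add up to 1 / x since a + b = 1. *)
  by rewrite -opprD !div1r !invfM !invrK -mulrDr ab1 mulr1.
rewrite fdd_weighted_max.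
under eq_bigr do rewrite fdd_weighted_max.
(* Division by n + 1 commutes with division by [a] or [b], so each factor is handled by the
   max-stability of its own process. *)
rewrite big_split/= -XM -YM.
by congr (F t (orthant _) * G t (orthant _))%E;
  apply/funext => i; rewrite mulrAC.
Qed.

Lemma is_ECF_weighted_max theta theta' :
  is_ECF X theta -> is_ECF Y theta' ->
  is_ECF weighted_max_RV (fun A => a * theta A + b * theta' A).
Proof.
move=> [tX0 tX] [tY0 tY]; split=> [|A x A0 x0].
  by rewrite tX0 tY0 !mulr0 addr0.
have [xa0 xb0] : 0 < x / a /\ 0 < x / b by rewrite !divr_gt0.
(* An ECF can be evaluated at any positive level: x / a and x / b produce exactly the two factors of
   the joint distribution function, and the weights cancel the denominators. *)
rewrite (tX A _ A0 xa0) (tY A _ A0 xb0) !fdd_orthant_bigmax fdd_weighted_max.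
have Ffin := @fdd_orthant_fin_num _ _ _ _ P (fun t => X t) _ (in_tuple A)
  (fun=> x / a) (fun t => measurable_funPT (X t)).
have Gfin := @fdd_orthant_fin_num _ _ _ _ P' (fun t => Y t) _ (in_tuple A)
  (fun=> x / b) (fun t => measurable_funPT (Y t)).
have F0 := simple_max_stable_fdd_gt0 (in_tuple A) msX xa0.
have G0 := simple_max_stable_fdd_gt0 (in_tuple A) msY xb0.
(* Splitting the logarithm of the product requires both factors to be finite and positive. *)
rewrite fineM// lnM ?posrE ?fine_gt0 ?F0 ?G0 -?ge0_fin_numE ?ltW//.
by field; rewrite !gt_eqF.
Qed.

End weighted_max.

Theorem corollary13 (R : realType) (T : choiceType) :
  convex_set (@Theta R T).
Proof.
(* It suffices to treat weights strictly between 0 and 1, which makes both [a] and [b] positive. *)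
apply/convex_setW => theta theta' /set_mem[theta_ge0].
move=> [d [W [P [X [msX ecfX]]]]] /set_mem[theta'_ge0].
move=> [d' [W' [P' [Y [msY ecfY]]]]] l l0 l1; apply/mem_set.
pose a : R := l%:num; pose b := 1 - a.
have b0 : 0 < b by rewrite subr_gt0.
rewrite -[theta <| l |> theta']/(fun A => a * theta A + b * theta' A : R^o).
split=> [A|]; first by rewrite addr_ge0// mulr_ge0// ltW.
exists _, _, _, (weighted_max_RV X Y a b); split.
  by apply: simple_max_stable_weighted_max; rewrite // addrC subrK.
exact: is_ECF_weighted_max.
Qed.
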